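(* Consider a SOCO problem with a one-dimensional decision space and a norm $\|\cdot\|$ on $\mathbb{R}$. Let $\theta\ge1$ and let $N$ be the norm on $\mathbb{R}$ with $N(1)=\theta\|1\|$ (i.e. $N(x)=\theta\|x\|$). Then the algorithm RBG($N$) attains $\alpha$-unfair competitive ratio $CR_1^\alpha$ at most $(1+\theta)/\min\{\theta,\alpha\}$ (for every $\alpha\ge1$) and regret $R'_0$ of $O(\max\{T/\theta,\theta\})$.
   Context: Setting: the decision space is a compact interval $F=[x_L,x_H]\subseteq\mathbb{R}^+$, $\|\cdot\|$ is a norm on $\mathbb{R}$, and the cost functions $c^t:F\to\mathbb{R}^+$ are convex with subgradients uniformly bounded over the sequence, and bounded above by a constant independent of $T$. An online (possibly randomized) algorithm produces $x^1,x^2,\dots\in F$ with $x^s$ depending only on $c^1,\dots,c^{s-1}$ and internal randomness. For $\alpha\ge0$ and lookahead $i$, $C_i^\alpha(A)=\mathbb{E}\big[\sum_{t=1}^T c^t(x^{t+i})+\alpha\|x^{t+i}-x^{t+i-1}\|\big]$ with initial action $x^i=0$; $C_i=C_i^1$. $OPT_s=\min_{x\in F}\sum_{t=1}^T c^t(x)$; $OPT_d^\alpha=\min_{x\in F^T}\sum_{t=1}^T c^t(x^t)+\alpha\|x^t-x^{t-1}\|$ with $x^0=0$. The regret $R'_0(A)$ is (at most) $\rho(T)$ if $C_0^1(A)-OPT_s\le\rho(T)$ for every cost sequence; the $\alpha$-unfair competitive ratio $CR_1^\alpha(A)$ is (at most) $\rho$ if $C_1(A)\le\rho\,OPT_d^\alpha+O(1)$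 for every cost sequence. Algorithm RBG($N$) (Randomly Biased Greedy): define the work function $w^0(x)=N(x)$ and $w^t(x)=\min_{y\in F}\{w^{t-1}(y)+c^t(y)+N(x-y)\}$ for $x\in F$; draw a single random number $r$ uniformly from $(-1,1)$; at each time step $t$, choose $x^t\in F$ minimizing $Y^t(x)=w^{t-1}(x)+rN(x)$. *)

(* Defs.v *)
From HB Require Import structures.
From mathcomp Require Import all_boot all_order all_algebra.
From mathcomp Require Import all_classical all_reals all_analysis.
Set Implicit Arguments. Unset Strict Implicit. Unset Printing Implicit Defensive.
Import Order.TTheory GRing.Theory Num.Theory.
Import numFieldNormedType.Exports.
Local Open Scope classical_set_scope.
Local Open Scope ring_scope.

Section SOCO.
Variable R : realType.

Definition inF (xL xH x : R) : Prop := xL <= x <= xH.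

Definition is_norm (nrm : R -> R) : Prop :=
  (forall x, nrm x = 0 -> x = 0) /\
  (forall a x, nrm (a * x) = `|a| * nrm x) /\
  (forall x y, nrm (x + y) <= nrm x + nrm y).

Definition convex_on (xL xH : R) (f : R -> R) : Prop :=
  forall x y (l : R), inF xL xH x -> inF xL xH y -> 0 <= l <= 1 ->
    f (l * x + (1 - l) * y) <= l * f x + (1 - l) * f y.

Definition subgrad (xL xH : R) (f : R -> R) (x g : R) : Prop :=
  forall y, inF xL xH y -> f x + g * (y - x) <= f y.

Definition admissible_costs (xL xH G B : R) (c : nat -> R -> R) : Prop :=
  forall t, convex_on xL xH (c t) /\
    (forall x, inF xL xH x -> 0 <= c t x <= B) /\
    (forall x, inF xL xH x -> exists g, `|g| <= G /\ subgrad xL xH (c t) x g).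

Fixpoint work (xL xH : R) (nrm : R -> R) (theta : R) (c : nat -> R -> R)
    (t : nat) (x : R) : R :=
  match t with
  | O => theta * nrm x
  | S t' => inf [set work xL xH nrm theta c t' y + c t y + theta * nrm (x - y)
                 | y in [set y | inF xL xH y]]
  end.

(* sel t r is an RBG(N) action at time t (t >= 1) for random number r *)
Definition RBG_selection (xL xH : R) (nrm : R -> R) (theta : R)
    (c : nat -> R -> R) (sel : nat -> R -> R) : Prop :=
  forall t r, (1 <= t)%N -> -1 < r < 1 ->
    inF xL xH (sel t r) /\
    forall y, inF xL xH y ->
      work xL xH nrm theta c t.-1 (sel t r) + r * (theta * nrm (sel t r))
      <= work xL xH nrm theta c t.-1 y + r * (theta * nrm y).

Definition measurable_on_pm1 (f : R -> R) : Prop :=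
  measurable_fun (`](-1)%R, 1%R[ : set R) f.

Definition Er (f : R -> R) : \bar R :=
  ((2^-1)%:E * \int[@lebesgue_measure R]_(r in `](-1)%R, 1%R[) (f r)%:E)%E.

(* cost with lookahead 0: x^0 = 0, sum_{t=1}^T c^t(x^t) + alpha ||x^t - x^{t-1}|| *)
Definition cost0 (nrm : R -> R) (alpha : R) (c : nat -> R -> R) (T : nat)
    (x : nat -> R) : R :=
  let x' := fun s => if s == 0%N then 0 else x s in
  \sum_(1 <= t < T.+1) (c t (x' t) + alpha * nrm (x' t - x' t.-1)).

(* cost with lookahead 1: x^1 = 0, sum_{t=1}^T c^t(x^{t+1}) + alpha ||x^{t+1} - x^t|| *)
Definition cost1 (nrm : R -> R) (alpha : R) (c : nat -> R -> R) (T : nat)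
    (x : nat -> R) : R :=
  let x' := fun s => if s == 1%N then 0 else x s in
  \sum_(1 <= t < T.+1) (c t (x' t.+1) + alpha * nrm (x' t.+1 - x' t)).

Definition OPT_d (xL xH : R) (nrm : R -> R) (alpha : R) (c : nat -> R -> R)
    (T : nat) : R :=
  inf [set cost0 nrm alpha c T x | x in
        [set x : nat -> R | forall t, (1 <= t <= T)%N -> inF xL xH (x t)]].

Definition OPT_s (xL xH : R) (c : nat -> R -> R) (T : nat) : R :=
  inf [set \sum_(1 <= t < T.+1) c t x | x in [set x | inF xL xH x]].

End SOCO.

(* Main.v *)
(* On F the norm N is x |-> m x with m = theta ||1||. The work functions w^t are
   convex and m-Lipschitz, and x^{t+1} minimizes w^t + r m x with |r| < 1, which
   forces w^t(x^{t+1}) = w^{t-1}(x^{t+1}) + c^t(x^{t+1}). Comparing with the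
   minimality of x^t, the service cost telescopes to at most
   min_F w^T + O(1).

   For the movement, let z minimize c^t and d = w^t - w^{t-1}; d decreases left of
   z and increases right of z, so x^t(r) moves towards z. The points min(x^t(r), z)
   and max(x^t(r), z) minimize the tilted work function over [a,z] and [z,b], so
   by the envelope theorem their integrals over r in (-1,1) are differences of
   values of w^{t-1} at a, z, b. Hence m E|x^{t+1} - x^t| <= (d(a) + d(b)) / 2,
   which telescopes to (w^T(a) + w^T(b)) / 2 <= w^T(a) + O(1). Finally w^T(a) is
   compared with OPT_d through a dynamic path, and with OPT_s or T B through a
   static one. *)
Require Import Defs.
From HB Require Import structures.
From mathcomp Require Import all_boot all_order all_algebra.
From mathcomp Require Import all_classical all_reals all_analysis.
From mathcomp Require Import measurable_realfun ring lra.
Set Implicit Arguments.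
Unset Strict Implicit.
Import Order.TTheory GRing.Theory Num.Theory.
Import numFieldNormedType.Exports.
Local Open Scope classical_set_scope.
Local Open Scope ring_scope.

(** * Lipschitz and convex functions on an interval *)

Definition lip_on {R : realType} (a b m : R) (w : R -> R) : Prop :=
  forall x y, inF a b x -> inF a b y -> w x - w y <= m * `|x - y|.

(** The infimum defining the next work function, encoded by near-minimizers so that no minimum has
    to be attained. *)
Definition work_step {R : realType} (a b m : R) (w c w' : R -> R) : Prop :=
  (forall x y, inF a b x -> inF a b y -> w' x <= w y + c y + m * `|x - y|) /\
  (forall x e, inF a b x -> 0 < e ->
    exists2 y, inF a b y & w y + c y + m * `|x - y| < w' x + e).

(** For a nonnegative interval and [m] the slope of [N], the term [r * m * p] is [r] times [N p]:
    this is the action rule at random number [r]. *)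
Definition tilted_min {R : realType} (a b m : R) (w : R -> R) (r p : R) : Prop :=
  inF a b p /\ forall y, inF a b y -> w p + r * m * p <= w y + r * m * y.

Lemma is_norm_scale {R : realType} (nrm : R -> R) :
  is_norm nrm -> exists2 k : R, 0 < k & forall x, nrm x = k * `|x|.
Proof.
move=> [n0 [nM nD]]; exists (nrm 1); last first.
  by move=> x; rewrite -{1}[x]mulr1 nM mulrC.
have nz : nrm 1 != 0.
  by apply/eqP => /n0/eqP; rewrite oner_eq0.
have h0 : nrm 0 = 0 by rewrite -{1}(mul0r (0 : R)) nM normr0 mul0r.
have hN : nrm (-1) = nrm 1 by rewrite -[-1]mulr1 nM normrN1 mul1r.
have := nD 1 (-1); rewrite subrr h0 hN => h.
by rewrite lt_def nz /=; lra.
Qed.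

Lemma inF_convex {R : realType} (a b x y l : R) :
  inF a b x -> inF a b y -> 0 <= l <= 1 -> inF a b (l * x + (1 - l) * y).
Proof.
move=> /andP[ax xb] /andP[ay yb] /andP[l0 l1]; apply/andP; split.
  have : 0 <= l * (x - a) by apply: mulr_ge0; lra.
  have : 0 <= (1 - l) * (y - a) by apply: mulr_ge0; lra.
  lra.
have : 0 <= l * (b - x) by apply: mulr_ge0; lra.
have : 0 <= (1 - l) * (b - y) by apply: mulr_ge0; lra.
lra.
Qed.

Lemma convex_on_between {R : realType} (a b : R) (f : R -> R) (y v z : R) :
  convex_on a b f -> inF a b y -> inF a b z -> (y <= v <= z) || (z <= v <= y) ->
  exists2 l : R, 0 <= l <= 1 & f v <= l * f y + (1 - l) * f z.
Proof.
move=> cf Fy Fz yvz; have [yz|yz] := eqVneq y z.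
  have -> : v = z by subst y; apply/eqP; rewrite eq_le; lra.
  by exists 0; lra.
have [l l01 ->] : exists2 l : R, 0 <= l <= 1 & v = l * y + (1 - l) * z.
  have yz0 : y - z != 0 by rewrite subr_eq0.
  exists ((v - z) / (y - z)); last by field.
  case/orP: yvz => h.
    have d : y - z < 0 by rewrite lt_neqAle yz0 /=; lra.
    by rewrite ler_ndivlMr // ler_ndivrMr //; lra.
  have d : 0 < y - z by rewrite lt_neqAle eq_sym yz0 /=; lra.
  by rewrite ler_pdivlMr // ler_pdivrMr //; lra.
by exists l => //; exact: cf.
Qed.

Lemma convex_on_min_between {R : realType} (a b : R) (f : R -> R) (y v z : R) :
  convex_on a b f -> inF a b y -> inF a b z -> f z <= f y ->
  (y <= v <= z) || (z <= v <= y) -> f v <= f y.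
Proof.
move=> cf Fy Fz zy /(convex_on_between cf Fy Fz) [l l01 h]; nra.
Qed.

Lemma convex_on_tilt {R : realType} (a b s : R) (f : R -> R) :
  convex_on a b f -> convex_on a b (fun x => f x + s * x).
Proof.
move=> cf x y l Fx Fy l01; have := cf x y l Fx Fy l01; lra.
Qed.

(** * One step of the work function and its tilted minimizers *)

Lemma work_step_lipschitz {R : realType} (a b m : R) (w c w' : R -> R) :
  0 <= m -> work_step a b m w c w' -> lip_on a b m w'.
Proof.
move=> m0 [h1 h2] x y Fx Fy; apply/ler_addgt0Pr => e e0.
have [z Fz hz] := h2 y e Fy e0; have := h1 x z Fx Fz.
have := ler_wpM2l m0 (ler_distD y x z); lra.
Qed.

(** The minimized expression is jointly convex in both points, so near-minimizers at [x] and [y]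
    combine into a competitor at the combined point. *)
Lemma work_step_convex {R : realType} (a b m : R) (w c w' : R -> R) :
  0 <= m -> convex_on a b w -> convex_on a b c ->
  work_step a b m w c w' -> convex_on a b w'.
Proof.
move=> m0 cw cc [h1 h2] x y l Fx Fy l01; apply/ler_addgt0Pr => e e0.
have [x1 Fx1 hx] := h2 x e Fx e0; have [y1 Fy1 hy] := h2 y e Fy e0.
have := h1 _ _ (inF_convex Fx Fy l01) (inF_convex Fx1 Fy1 l01).
have := cw _ _ _ Fx1 Fy1 l01; have := cc _ _ _ Fx1 Fy1 l01.
have /andP[l0 l1] := l01; have l1' : 0 <= 1 - l by lra.
have dist : `|l * x + (1 - l) * y - (l * x1 + (1 - l) * y1)|
    <= l * `|x - x1| + (1 - l) * `|y - y1|.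
  have -> : l * x + (1 - l) * y - (l * x1 + (1 - l) * y1)
    = l * (x - x1) + (1 - l) * (y - y1) by ring.
  apply: le_trans (ler_normD _ _) _.
  by rewrite !normrM (ger0_norm l0) (ger0_norm l1').
have := ler_wpM2l m0 dist; have := ler_wpM2l l0 (ltW hx).
have := ler_wpM2l l1' (ltW hy); lra.
Qed.

Lemma work_step_ge {R : realType} (a b m : R) (w c w' : R -> R) (x : R) :
  lip_on a b m w -> (forall y, inF a b y -> 0 <= c y) ->
  work_step a b m w c w' -> inF a b x -> w x <= w' x.
Proof.
move=> lw c0 [_ h2] Fx; apply/ler_addgt0Pr => e e0.
have [y Fy hy] := h2 x e Fx e0.
have := lw x y Fx Fy; have := c0 y Fy; lra.
Qed.

(* An optimal detour [y] from [q] either passes through [v], in which case it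
   serves [v] as well, or makes the increment at [q] at least [c v]. *)
Lemma work_step_increment_le {R : realType} (a b m : R) (w c w' : R -> R) (q v : R) :
  lip_on a b m w -> work_step a b m w c w' -> inF a b q -> inF a b v ->
  (forall y, inF a b y -> `|q - y| = `|q - v| + `|v - y| \/ c v <= c y) ->
  w' v - w v <= w' q - w q.
Proof.
move=> lw [h1 h2] Fq Fv H; apply/ler_addgt0Pr => e e0.
have [y Fy hy] := h2 q e Fq e0.
have [d|cvy] := H y Fy.
  have := h1 v y Fv Fy; have := lw q v Fq Fv.
  by move: hy; rewrite d; lra.
have := h1 v v Fv Fv; rewrite subrr normr0.
have := lw q y Fq Fy; lra.
Qed.

(** Here [v] lies between [q] and each of [p], [z]. Convexity towards [p] bounds the change of [w]
    from [q] to [v], the increment bound passes this on to [w'], and optimality of [q] bounds the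
    change of [w'] from the other side. *)
Lemma tilted_min_compare {R : realType} (a b m : R) (w c w' : R -> R) (z r s p q v : R) :
  0 < m -> convex_on a b w -> lip_on a b m w -> convex_on a b c ->
  work_step a b m w c w' ->
  inF a b z -> (forall y, inF a b y -> c z <= c y) ->
  tilted_min a b m w s p -> tilted_min a b m w' r q ->
  (q <= v <= Num.min p z) || (Num.max p z <= v <= q) ->
  (s - r) * (v - q) <= 0.
Proof.
move=> m0 cw lw cc st Fz zmin [Fp pmin] [Fq qmin]; rewrite le_min ge_max => hv.
have Fv : inF a b v by move: Fp Fz Fq hv; rewrite /inF; lra.
have h1 : w v + s * m * v <= w q + s * m * q.
  apply: (convex_on_min_between (convex_on_tilt (s * m) cw) Fq Fp).
    exact: pmin.
  by move: hv; lra.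
have h2 : w' v - w v <= w' q - w q.
  apply: work_step_increment_le lw st Fq Fv _ => y Fy.
  have [qv|vq|<-] := ltgtP q v; last by left; rewrite subrr normr0 add0r.
    have [yv|vy] := lerP y v.
      right; apply: (convex_on_min_between cc Fy Fz (zmin _ Fy)).
      by move: hv; lra.
    by left; rewrite !ler0_norm; lra.
  have [yv|vy] := lerP y v.
    by left; rewrite !ger0_norm; lra.
  right; apply: (convex_on_min_between cc Fy Fz (zmin _ Fy)).
  by move: hv; lra.
have h3 := qmin v Fv.
have : m * ((s - r) * (v - q)) <= 0 by lra.
by rewrite pmulr_rle0.
Qed.

(** If [q] were left of both [p] and [z], the comparison would force [s <= r]. Strictness matters:
    minimizers may be non-unique, and at [r = s] the comparison says nothing. *)
Lemma tilted_min_ge_left {R : realType} (a b m : R) (w c w' : R -> R) (z r s p q : R) :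
  0 < m -> convex_on a b w -> lip_on a b m w -> convex_on a b c ->
  work_step a b m w c w' ->
  inF a b z -> (forall y, inF a b y -> c z <= c y) ->
  tilted_min a b m w s p -> tilted_min a b m w' r q -> r < s ->
  Num.min p z <= q.
Proof.
move=> m0 cw lw cc st Fz zmin hp hq rs; rewrite leNgt; apply/negP => qlt.
have := tilted_min_compare (v := Num.min p z) m0 cw lw cc st Fz zmin hp hq.
rewrite lexx (ltW qlt) => /(_ erefl); nra.
Qed.

Lemma tilted_min_le_right {R : realType} (a b m : R) (w c w' : R -> R) (z r s p q : R) :
  0 < m -> convex_on a b w -> lip_on a b m w -> convex_on a b c ->
  work_step a b m w c w' ->
  inF a b z -> (forall y, inF a b y -> c z <= c y) ->
  tilted_min a b m w s p -> tilted_min a b m w' r q -> s < r ->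
  q <= Num.max p z.
Proof.
move=> m0 cw lw cc st Fz zmin hp hq rs; rewrite leNgt; apply/negP => qlt.
have := tilted_min_compare (v := Num.max p z) m0 cw lw cc st Fz zmin hp hq.
rewrite lexx (ltW qlt) orbT => /(_ erefl); nra.
Qed.

(** * Envelopes and area bounds *)

(** A derivative-free form of [W' = m P] with [W] concave; for [m > 0] it forces [P] to be
    nonincreasing. *)
Definition envelope {R : realType} (m : R) (P W : R -> R) : Prop :=
  forall r s, -1 <= r -> r < s -> s <= 1 ->
    (s - r) * (m * P s) <= W s - W r <= (s - r) * (m * P r).

(* [f] lies below the increments of [A] on every subinterval of [-1,1], up to a
   term whose total over a subdivision vanishes with its mesh: a measurable such
   [f] has integral at most [A 1 - A (-1)]. *)
Definition area_le {R : realType} (f : R -> R) (D : R) : Prop :=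
  exists A E : R -> R, (forall r u s, -1 <= r -> r < u -> u < s -> s <= 1 ->
    (s - r) * f u <= A s - A r + (s - r) * (E r - E s)) /\ A 1 - A (-1) <= D.

(** The envelope theorem: [P s] competes with [P r] at tilt [r], and [P r] with [P s] at tilt
    [s]. *)
Lemma envelope_of_min {R : realType} (m : R) (w P : R -> R) :
  (forall r s, -1 <= r <= 1 -> -1 <= s <= 1 ->
    w (P r) + r * m * P r <= w (P s) + r * m * P s) ->
  envelope m P (fun r => w (P r) + r * m * P r).
Proof.
move=> H r s r1 rs s1.
have := H r s; have := H s r; rewrite r1 s1.
have -> : r <= 1 by lra.
have -> : -1 <= s by lra.
move=> /(_ isT isT) h1 /(_ isT isT) h2; lra.
Qed.

Lemma envelope_gap {R : realType} (m : R) (P Q WP WQ : R -> R) :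
  0 < m -> envelope m P WP -> envelope m Q WQ ->
  (forall r s, -1 <= r -> r < s -> s <= 1 -> P s <= Q r) ->
  area_le (fun u => m * `|Q u - P u|) (WQ 1 - WP 1 - (WQ (-1) - WP (-1))).
Proof.
move=> m0 eP eQ PQ; exists (fun s => WQ s - WP s).
(* One [Q r - Q s] and one [P r - P s] pay for reading the slopes at the other endpoint; two more
   [P r - P s] cover, with room to spare, points where [Q u < P u]. *)
exists (fun s => m * (Q s + 3 * P s)); split; last exact: lexx.
move=> r u s r1 ru us s1.
have noninc (f W : R -> R) : envelope m f W ->
    forall x y, -1 <= x -> x < y -> y <= 1 -> f y <= f x.
  move=> ef x y x1 xy y1; have := ef x y x1 xy y1.
  have yx : 0 < y - x by lra.
  by move=> /andP[/le_trans h /h]; rewrite ler_pM2l // ler_pM2l.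
have rs : r < s by lra.
have ul1 : u <= 1 by lra.
have u1 : -1 <= u by lra.
have Pru := noninc _ _ eP _ _ r1 ru ul1.
have Pus := noninc _ _ eP _ _ u1 us s1.
have Qru := noninc _ _ eQ _ _ r1 ru ul1.
have hPQ := PQ _ _ u1 us s1.
have /andP[eP1 eP2] := eP _ _ r1 rs s1.
have /andP[eQ1 eQ2] := eQ _ _ r1 rs s1.
have h : `|Q u - P u| <= Q r - P s + 2 * (P r - P s).
  by rewrite ler_norml; lra.
have srm : 0 <= (s - r) * m by apply: mulr_ge0; lra.
have := ler_wpM2l srm h; lra.
Qed.

Lemma area_le_mono {R : realType} (f g : R -> R) (D D' : R) :
  area_le g D -> (forall u, -1 < u < 1 -> f u <= g u) -> D <= D' -> area_le f D'.
Proof.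
move=> [A [E [H hD]]] fg DD; exists A, E; split; last exact: le_trans DD.
move=> r u s r1 ru us s1; apply: le_trans (H r u s r1 ru us s1).
by apply: ler_wpM2l; [lra | apply: fg; lra].
Qed.

Lemma area_le_cst {R : realType} (k : R) : area_le (fun=> k) (2 * k).
Proof.
exists (fun s => k * s), (fun=> 0); split; last lra.
by move=> *; lra.
Qed.

Lemma area_leD {R : realType} (f g : R -> R) (D D' : R) :
  area_le f D -> area_le g D' -> area_le (fun u => f u + g u) (D + D').
Proof.
move=> [A [E [H hD]]] [A' [E' [H' hD']]].
exists (fun s => A s + A' s), (fun s => E s + E' s); split; last lra.
move=> r u s r1 ru us s1.
have := H r u s r1 ru us s1; have := H' r u s r1 ru us s1; lra.
Qed.

Lemma area_leZ {R : realType} (k : R) (f : R -> R) (D : R) :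
  0 <= k -> area_le f D -> area_le (fun u => k * f u) (k * D).
Proof.
move=> k0 [A [E [H hD]]]; exists (fun s => k * A s), (fun s => k * E s).
split; last by have := ler_wpM2l k0 hD; lra.
move=> r u s r1 ru us s1; have := ler_wpM2l k0 (H r u s r1 ru us s1); lra.
Qed.

Lemma area_le_sum {R : realType} (T : nat) (f : nat -> R -> R) (D : nat -> R) :
  (forall t, (1 <= t)%N -> area_le (f t) (D t)) ->
  area_le (fun u => \sum_(1 <= t < T.+1) f t u) (\sum_(1 <= t < T.+1) D t).
Proof.
move=> H; elim: T => [|T IH].
  rewrite big_geq //; apply: area_le_mono (area_le_cst 0) _ _; last lra.
  by move=> u _; rewrite big_geq.
rewrite big_nat_recr //=.
apply: area_le_mono (area_leD IH (H T.+1 isT)) _ (lexx _).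
by move=> u _; rewrite big_nat_recr.
Qed.

(** Clipping at [z] splits a move into a part below and a part above [z], each a gap between two
    clipped minimizers whose order is known. *)
Lemma dist_min_max {R : realType} (p q z : R) :
  `|q - p| = `|Num.min q z - Num.min p z| + `|Num.max p z - Num.max q z|.
Proof.
have [qz|qz] := lerP q z; have [pz|pz] := lerP p z.
- by rewrite subrr normr0 addr0.
- rewrite (@ler0_norm _ (q - p)) ?(@ler0_norm _ (q - z)) ?ger0_norm; lra.
- rewrite (@ger0_norm _ (q - p)) ?(@ler0_norm _ (z - q)) ?ger0_norm; lra.
- by rewrite subrr normr0 add0r distrC.
Qed.

Lemma movement_area {R : realType} (a b m : R) (w c w' p q : R -> R) (z : R) :
  0 < m -> a <= b -> convex_on a b w -> convex_on a b w' ->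
  lip_on a b m w -> convex_on a b c -> (forall y, inF a b y -> 0 <= c y) ->
  work_step a b m w c w' ->
  inF a b z -> (forall y, inF a b y -> c z <= c y) ->
  (forall r, -1 <= r <= 1 -> tilted_min a b m w r (p r)) ->
  (forall r, -1 <= r <= 1 -> tilted_min a b m w' r (q r)) ->
  p (-1) = b -> p 1 = a -> q (-1) = b -> q 1 = a ->
  area_le (fun u => m * `|q u - p u|) (w' a - w a + (w' b - w b)).
Proof.
move=> m0 ab cw cw' lw cc c0 st Fz zmin hp hq pN1 p1 qN1 q1.
have /andP[az zb] := Fz.
(* The clipped point [min (x r) z] lies between the competitor [min (x s) z] and the minimizer [x r]
   of a convex function, so clipping keeps optimality among clipped points. *)
have minl f x : convex_on a b f ->
    (forall r, -1 <= r <= 1 -> tilted_min a b m f r (x r)) ->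
    envelope m (fun r => Num.min (x r) z)
      (fun r => f (Num.min (x r) z) + r * m * Num.min (x r) z).
  move=> cf hx; apply: (envelope_of_min (P := fun r => Num.min (x r) z)) => r s hr hs.
  have [Fx xmin] := hx r hr; have [Fs _] := hx s hs.
  have F' : inF a b (Num.min (x s) z).
    by move: Fs Fz; rewrite /inF; case: (lerP (x s) z) => h; lra.
  apply: (convex_on_min_between (convex_on_tilt (r * m) cf) F' Fx).
    exact: xmin.
  by case: (lerP (x r) z) => h1; case: (lerP (x s) z) => h2; move: Fx Fs; rewrite ?lexx ?orbT; lra.
have maxr f x : convex_on a b f ->
    (forall r, -1 <= r <= 1 -> tilted_min a b m f r (x r)) ->
    envelope m (fun r => Num.max (x r) z)
      (fun r => f (Num.max (x r) z) + r * m * Num.max (x r) z).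
  move=> cf hx; apply: (envelope_of_min (P := fun r => Num.max (x r) z)) => r s hr hs.
  have [Fx xmin] := hx r hr; have [Fs _] := hx s hs.
  have F' : inF a b (Num.max (x s) z).
    by move: Fs Fz; rewrite /inF; case: (lerP (x s) z) => h; lra.
  apply: (convex_on_min_between (convex_on_tilt (r * m) cf) F' Fx).
    exact: xmin.
  by case: (lerP (x r) z) => h1; case: (lerP (x s) z) => h2; move: Fx Fs; rewrite ?lexx ?orbT; lra.
have gapl := envelope_gap m0 (minl _ _ cw hp) (minl _ _ cw' hq).
have gapr := envelope_gap m0 (maxr _ _ cw' hq) (maxr _ _ cw hp).
apply: area_le_mono (area_leD (gapl _) (gapr _)) _ _.
- move=> r s r1 rs s1; rewrite le_min; apply/andP; split; last by rewrite ge_min lexx orbT.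
  apply: (tilted_min_ge_left m0 cw lw cc st Fz zmin (hp s _) (hq r _) rs); lra.
- move=> r s r1 rs s1; rewrite ge_max; apply/andP; split; last by rewrite le_max lexx orbT.
  apply: (tilted_min_le_right m0 cw lw cc st Fz zmin (hp r _) (hq s _) rs); lra.
- by move=> u _; rewrite -mulrDr -dist_min_max.
(* The tilts cancel at both ends. With [d = w' - w] the total is [d a + d b - 2 * d z], and
   [d z >= 0]. *)
rewrite p1 q1 pN1 qN1 (min_l az) (min_r zb) (max_r az) (max_l zb).
have := work_step_ge lw c0 st Fz; lra.
Qed.

(** * Integration over the random number *)

(** Under bisection the increments of [A] telescope while the total error term in [E] is halved each
    time, so it vanishes in the limit. *)
Lemma integral_le_area {R : realType} (f : R -> R) (D : R) :
  measurable_on_pm1 f -> (forall u, -1 < u < 1 -> 0 <= f u) -> area_le f D ->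
  (Er f <= (D / 2)%:E)%E.
Proof.
move=> mf f0 [A [E [H hD]]].
pose I (r s : R) := (\int[@lebesgue_measure R]_(u in `]r, s[) (f u)%:E)%E.
have sub (r s : R) : -1 <= r -> s <= 1 -> `]r, s[ `<=` `](-1)%R, 1%R[.
  by move=> r1 s1 u /=; rewrite !in_itv /=; lra.
have mI (r s : R) : -1 <= r -> s <= 1 -> measurable_fun (`]r, s[ : set R) f.
  by move=> r1 s1; apply: measurable_funS mf => //; exact: sub.
(* The pieces stay open because the midpoint is a null set. *)
have split (r x s : R) : -1 <= r -> r < x -> x < s -> s <= 1 ->
    I r s = (I r x + I x s)%E.
  move=> r1 rx xs s1; rewrite /I.
  have e : [set` `]r, s[] = [set` `]r, x]] `|` [set` `]x, s[].
    by apply: itv_bndbnd_setU; rewrite bnd_simp ?ltW.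
  rewrite e ge0_integral_setU //.
  - have mx : measurable_fun (`]r, x[ : set R) f by apply: mI; lra.
    congr (_ + _)%E; apply/esym.
    apply: (@integral_itv_bndo_bndc R (BRight r) x (EFin \o f)).
    exact/measurable_EFinP.
  - by rewrite -e; apply/measurable_EFinP; exact: mI.
  - by rewrite -e => u /(sub _ _ r1 s1) /=; rewrite in_itv /= lee_fin; exact: f0.
  - by apply/disj_setPS => u /= []; rewrite !in_itv /=; lra.
have bis n (r s : R) : -1 <= r -> r < s -> s <= 1 ->
    (I r s <= (A s - A r + (s - r) / 2 ^+ n * (E r - E s))%:E)%E.
  elim: n r s => [|n IH] r s r1 rs s1.
    rewrite expr0 divr1.
    pose k := (A s - A r + (s - r) * (E r - E s)) / (s - r).
    have vol : (@lebesgue_measure R) `]r, s[%classic = (s - r)%:E.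
      by rewrite lebesgue_measure_itv /= lte_fin rs -EFinD.
    have <- : (\int[@lebesgue_measure R]_(u in `]r, s[) (cst k%:E u))%E
        = (A s - A r + (s - r) * (E r - E s))%:E.
      by rewrite integral_cst //= vol -EFinM divfK //; lra.
    apply: ge0_le_integral => //.
    - by move=> u /(sub _ _ r1 s1) /=; rewrite in_itv /= lee_fin; exact: f0.
    - apply/measurable_EFinP; exact: mI.
    - move=> u /=; rewrite in_itv /= => /andP[ru us].
      rewrite /cst lee_fin /k ler_pdivlMr ?subr_gt0 // mulrC.
      exact: H.
  have rx : r < (r + s) / 2 by lra.
  have xs : (r + s) / 2 < s by lra.
  rewrite (split r ((r + s) / 2) s) //.
  apply: le_trans (leeD (IH _ _ r1 rx _) (IH _ _ _ xs s1)) _; [lra|lra|].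
  rewrite -EFinD lee_fin exprS.
  have n0 : (2 ^+ n : R) != 0 by rewrite expf_neq0.
  rewrite le_eqVlt; apply/orP; left; apply/eqP; field.
  by rewrite n0.
have ID : (I (-1)%R 1%R <= D%:E)%E.
  apply/lee_addgt0Pr => e e0.
  pose n := Num.bound (2 * (E (-1) - E 1) / e).
  have hn : 2 * (E (-1) - E 1) / e < 2 ^+ n by exact: upper_nthrootP.
  apply: le_trans (bis n (-1) 1 _ _ _) _; [lra|lra|lra|].
  rewrite -EFinD lee_fin.
  have p0 : 0 < (2 ^+ n : R) by rewrite exprn_gt0.
  have : 2 * (E (-1) - E 1) / 2 ^+ n < e.
    by move: hn; rewrite !ltr_pdivrMr // [_ * e]mulrC.
  have -> : (1 - -1) / 2 ^+ n * (E (-1) - E 1) = 2 * (E (-1) - E 1) / 2 ^+ n :> R.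
    by rewrite mulrAC; congr (_ * _ / _); lra.
  lra.
rewrite /Er; apply: le_trans (lee_wpmul2l _ ID) _; first by rewrite lee_fin.
by rewrite -EFinM lee_fin mulrC.
Qed.

(** The integral of a nonnegative function is a supremum over the simple functions below it, a set
    that grows with the function. This brings in the cost of a run, of which only the movement bound
    is shown measurable. *)
Lemma Er_le {R : realType} (f g : R -> R) :
  (forall u, -1 < u < 1 -> 0 <= f u <= g u) -> (Er f <= Er g)%E.
Proof.
move=> fg; rewrite /Er; apply: lee_wpmul2l; first by rewrite lee_fin.
have f0 (u : R) : [set` `](-1)%R, 1%R[] u -> (0 <= (f u)%:E)%E.
  by rewrite /= in_itv /= lee_fin => /fg /andP[].
have g0 (u : R) : [set` `](-1)%R, 1%R[] u -> (0 <= (g u)%:E)%E.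
  by rewrite /= in_itv /= lee_fin => /fg /andP[/le_trans h /h].
rewrite ge0_integralE; last exact: f0.
rewrite [leRHS]ge0_integralE; last exact: g0.
apply: le_ereal_sup => _ [h hf <-]; exists h => // x.
apply: le_trans (hf x) _; rewrite /patch; case: ifPn => // xI.
by move: xI; rewrite inE /= in_itv /= lee_fin => /fg /andP[].
Qed.

(** * Minimizers of Lipschitz costs and of tilted work functions *)

Lemma lipschitz_on_argmin {R : realType} (a b G : R) (c : R -> R) :
  a <= b -> 0 <= G -> lip_on a b G c ->
  exists2 z, inF a b z & forall y, inF a b y -> c z <= c y.
Proof.
move=> ab G0 lc.
have cc : {within `[a, b], continuous c}.
  apply/subspace_continuousP => x /=; rewrite in_itv /= => Fx.
  apply/cvgrPdist_le => e e0; rewrite near_withinE.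
  have G1 : 0 < G + 1 by lra.
  (* The radius divides by [G + 1] since [G] may be 0. *)
  apply/nbhs_ballP; exists (e / (G + 1)); first exact: divr_gt0.
  move=> y /= xy Fy'; have Fy : inF a b y by move: Fy'; rewrite in_itv.
  have d : `|x - y| * (G + 1) <= e by rewrite -ler_pdivlMr // ltW.
  have h1 := lc x y Fx Fy; have h2 := lc y x Fy Fx; rewrite distrC in h2.
  have := normr_ge0 (x - y).
  by rewrite /from_subspace ler_norml; lra.
have [z zab zmin] := EVT_min ab cc; exists z; first by rewrite in_itv in zab.
by move=> y Fy; apply: zmin; rewrite in_itv.
Qed.

Lemma admissible_lipschitz {R : realType} (a b G B : R) (c : nat -> R -> R) (t : nat) :
  admissible_costs a b G B c -> lip_on a b G (c t).
Proof.
move=> /(_ t)[_ [_ sg]] x y Fx Fy; have [g [gG hg]] := sg x Fx.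
have := hg y Fy; have := ler_norm (g * (x - y)); rewrite normrM.
have := ler_wpM2r (normr_ge0 (x - y)) gG; lra.
Qed.

(* Since [|r| < 1], leaving [q] costs more than the tilt can recover, so the
   infimum defining [w' q] is approached only by points close to [q]. *)
Lemma tilted_min_stays {R : realType} (a b m G r q : R) (w c w' : R -> R) :
  0 < m -> 0 <= G -> -1 < r < 1 -> lip_on a b m w -> lip_on a b G c ->
  work_step a b m w c w' -> tilted_min a b m w' r q -> w q + c q <= w' q.
Proof.
move=> m0 G0 r1 lw lc [h1 h2] [Fq qmin].
have k0 : 0 < 1 - `|r| by have : `|r| < 1; [rewrite ltr_norml | lra].
have km0 : 0 < (1 - `|r|) * m by exact: mulr_gt0.
(* Slack [e / L] keeps the near-minimizer so close to [q] that the slack plus [G] times the distance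
   is at most [e]. *)
pose L := 1 + G / ((1 - `|r|) * m).
have L0 : 0 < L by have : 0 <= G / ((1 - `|r|) * m); [apply: divr_ge0; lra | rewrite /L; lra].
apply/ler_addgt0Pr => e e0.
have [y Fy hy] := h2 q (e / L) Fq (divr_gt0 e0 L0).
have := qmin y Fy; have := h1 y y Fy Fy; rewrite subrr normr0 => hyy hq.
have near : `|q - y| <= e / L / ((1 - `|r|) * m).
  rewrite ler_pdivlMr //.
  have : - (r * (q - y)) <= `|r| * `|q - y| by rewrite -normrM -normrN ler_norm.
  move=> /(ler_wpM2l (ltW m0)); lra.
have := lw q y Fq Fy; have := lc q y Fq Fy.
have := ler_wpM2l G0 near.
have -> : G * (e / L / ((1 - `|r|) * m)) = e - e / L.
  by rewrite /L; field; rewrite -?/L; lra.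
lra.
Qed.

(** At [r = -1] and [r = 1] the tilt has slope of size [m] and dominates an [m]-Lipschitz function.
    This fixes the boundary values of the movement integral. *)
Lemma tilted_min_endpoints {R : realType} (a b m : R) (w : R -> R) :
  a <= b -> lip_on a b m w ->
  tilted_min a b m w (-1) b /\ tilted_min a b m w 1 a.
Proof.
move=> ab lw.
have Fa : inF a b a by rewrite /inF; lra.
have Fb : inF a b b by rewrite /inF; lra.
split; split=> // y Fy; have /andP[ay yb] := Fy.
  by have := lw b y Fb Fy; rewrite ger0_norm; lra.
by have := lw a y Fa Fy; rewrite ler0_norm; lra.
Qed.

(** * Work functions along a cost sequence *)

Section WorkFunction.
Variables (R : realType) (a b k theta G B : R) (nrm : R -> R) (c : nat -> R -> R).
Hypotheses (a0 : 0 <= a) (ab : a <= b) (k0 : 0 < k) (theta1 : 1 <= theta).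
Hypothesis nrmE : forall x, nrm x = k * `|x|.
Hypothesis adm : admissible_costs a b G B c.

Local Notation m := (theta * k).
Local Notation w := (work a b nrm theta c).

Let m0 : 0 < m. Proof. exact: mulr_gt0 (lt_le_trans ltr01 theta1) k0. Qed.
Let Fa : inF a b a. Proof. by rewrite /inF lexx. Qed.
Let Fb : inF a b b. Proof. by rewrite /inF lexx andbT. Qed.
Let b0 : 0 <= b. Proof. exact: le_trans ab. Qed.
Let F0 x : inF a b x -> 0 <= x. Proof. by case/andP=> /(le_trans a0). Qed.
Let mb0 : 0 <= m * b. Proof. by apply: mulr_ge0 => //; exact: ltW. Qed.

Lemma admissible_ge0 t x : inF a b x -> 0 <= c t x.
Proof. by move=> Fx; have [_ [/(_ x Fx)/andP[]]] := adm t. Qed.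

Lemma admissible_bound_ge0 : 0 <= G /\ 0 <= B.
Proof.
have [_ [/(_ a Fa)/andP[h1 h2] /(_ a Fa) [g [gG _]]]] := adm 0.
by split; [exact: le_trans (normr_ge0 g) gG | exact: le_trans h2].
Qed.

Lemma work0E x : inF a b x -> w 0 x = m * x.
Proof. by move=> Fx; rewrite /= nrmE ger0_norm ?mulrA //; exact: F0. Qed.

(** Proved jointly: [inf] is a genuine greatest lower bound only for a set bounded below, which
    comes from nonnegativity one step earlier. *)
Lemma work_ge0_step t :
  (forall x, inF a b x -> 0 <= w t x) /\ work_step a b m (w t) (c t.+1) (w t.+1).
Proof.
have step t' : (forall x, inF a b x -> 0 <= w t' x) ->
    (forall x, inF a b x -> 0 <= w t'.+1 x) /\
    work_step a b m (w t') (c t'.+1) (w t'.+1).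
  move=> w0.
  pose S x := [set w t' y + c t'.+1 y + theta * nrm (x - y) | y in [set y | inF a b y]].
  have wE x : w t'.+1 x = inf (S x) by [].
  have lb x : lbound (S x) 0.
    move=> _ [y /= Fy <-]; rewrite nrmE mulrA.
    have := w0 y Fy; have := admissible_ge0 t'.+1 Fy.
    by have := mulr_ge0 (ltW m0) (normr_ge0 (x - y)); lra.
  have S0 x : (S x) !=set0 by eexists; exists a.
  split=> [x Fx|]; first by rewrite wE; exact: lb_le_inf.
  split=> [x y Fx Fy|x e Fx e0]; rewrite wE.
    by apply: ge_inf; [exists 0; exact: lb | exists y => //; rewrite nrmE mulrA].
  have [_ [y Fy <-] hy] : exists2 v, S x v & v < inf (S x) + e.
    by apply: inf_adherent => //; split; [exact: S0 | exists 0; exact: lb].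
  by exists y => //; move: hy; rewrite nrmE mulrA.
have all0 s : forall x, inF a b x -> 0 <= w s x.
  elim: s => [x Fx|s IH]; last by have [] := step s IH.
  rewrite work0E //; apply: mulr_ge0; first exact: ltW.
  exact: F0.
by split; [exact: all0 | have [] := step t (all0 t)].
Qed.

Lemma work_ge0 t x : inF a b x -> 0 <= w t x.
Proof. by have [h _] := work_ge0_step t; exact: h. Qed.

Lemma workS t : work_step a b m (w t) (c t.+1) (w t.+1).
Proof. by have [] := work_ge0_step t. Qed.

Lemma work_lipschitz t : lip_on a b m (w t).
Proof.
case: t => [|t]; last exact: work_step_lipschitz (ltW m0) (workS t).
by move=> x y Fx Fy; rewrite !work0E // -mulrBr ler_pM2l // ler_norm.
Qed.

Lemma work_convex t : convex_on a b (w t).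
Proof.
elim: t => [|t IH]; last first.
  by apply: work_step_convex (ltW m0) IH _ (workS t); have [] := adm t.+1.
move=> x y l Fx Fy l01; rewrite !work0E //; last exact: inF_convex.
lra.
Qed.

Lemma workS_le t x : inF a b x -> w t.+1 x <= w t x + c t.+1 x.
Proof.
by move=> Fx; have := (workS t).1 x x Fx Fx; rewrite subrr normr0 mulr0 addr0.
Qed.

Lemma work_le_static T x : inF a b x -> w T x <= m * b + \sum_(1 <= t < T.+1) c t x.
Proof.
move=> Fx; elim: T => [|T IH].
  rewrite big_geq // addr0 work0E // ler_pM2l //.
  by move/andP: Fx => [].
by rewrite big_nat_recr //=; have := workS_le T Fx; lra.
Qed.

Lemma work_le_dynamic T (x : nat -> R) :
  (forall t, (1 <= t <= T)%N -> inF a b (x t)) ->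
  w T a <= m * b + cost0 nrm theta c T x.
Proof.
move=> Fx; rewrite /cost0.
set x' := fun s => if s == 0%N then 0 else x s.
case: T Fx => [|T] Fx.
  by rewrite big_geq // work0E // addr0 ler_pM2l.
(* The work function at the current position is at most the cost so far, as [w 0] prices the first
   move from 0. The final move to [a] costs at most [m * b]. *)
have : w T.+1 (x T.+1) <=
    \sum_(1 <= t < T.+2) (c t (x' t) + theta * nrm (x' t - x' t.-1)).
  elim: T Fx => [|T IH] Fx.
    have F1 := Fx 1%N isT.
    rewrite big_nat1 /x' /= subr0 nrmE ger0_norm ?F0 //.
    by have := workS_le 0 F1; rewrite work0E //; lra.
  have F1 : inF a b (x T.+1) by apply: Fx; rewrite /= ltnW.
  have F2 : inF a b (x T.+2) by apply: Fx; rewrite /= leqnn.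
  rewrite big_nat_recr //= {2 3 4}/x' /= nrmE.
  have hIH : w T.+1 (x T.+1) <=
      \sum_(1 <= t < T.+2) (c t (x' t) + theta * nrm (x' t - x' t.-1)).
    by apply: IH => t /andP[t1 tT]; apply: Fx; rewrite t1 ltnW.
  have := workS_le T.+1 F2; have := work_lipschitz T.+1 F2 F1. lra.
have FT : inF a b (x T.+1) by apply: Fx; rewrite /= leqnn.
have := work_lipschitz T.+1 Fa FT; have /andP[aT Tb] := FT.
rewrite ler0_norm; last lra.
have := ler_wpM2l (ltW m0) Tb; have := mulr_ge0 (ltW m0) a0; lra.
Qed.

(** * Service and movement of the algorithm *)

Variable sel : nat -> R -> R.
Hypothesis rbg : RBG_selection a b nrm theta c sel.

Lemma RBG_inF t r : -1 < r < 1 -> inF a b (sel t.+1 r).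
Proof. by move=> hr; have [] := rbg (isT : (1 <= t.+1)%N) hr. Qed.

Lemma RBG_tilted_min t r : -1 < r < 1 -> tilted_min a b m (w t) r (sel t.+1 r).
Proof.
move=> hr; have [Fs smin] := rbg (isT : (1 <= t.+1)%N) hr.
have nE x : inF a b x -> r * (theta * nrm x) = r * m * x.
  by move=> Fx; rewrite nrmE ger0_norm ?mulrA // F0.
by split=> // y Fy; have := smin y Fy; rewrite !nE.
Qed.

Lemma RBG_service_le T r : -1 < r < 1 ->
  \sum_(1 <= t < T.+1) c t (sel t.+1 r) <= w T a + m * b.
Proof.
move=> hr.
(* The potential is the minimum of the tilted work function; each step raises it by at least the
   cost served. *)
have h : \sum_(1 <= t < T.+1) c t (sel t.+1 r)
    <= w T (sel T.+1 r) + r * m * sel T.+1 r.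
  elim: T => [|T IH].
    have Fs := RBG_inF 0 hr; rewrite big_geq // work0E //.
    have -> : m * sel 1 r + r * m * sel 1 r = m * ((1 + r) * sel 1 r) by ring.
    by apply: mulr_ge0; [exact: ltW | apply: mulr_ge0; [lra | exact: F0]].
  rewrite big_nat_recr //=.
  have [Fs smin] := RBG_tilted_min T hr.
  have := smin _ (RBG_inF T.+1 hr).
  have := tilted_min_stays m0 admissible_bound_ge0.1 hr (work_lipschitz T)
    (admissible_lipschitz T.+1 adm) (workS T) (RBG_tilted_min T.+1 hr).
  lra.
apply: le_trans h _; have [_ smin] := RBG_tilted_min T hr.
apply: le_trans (smin a Fa) _; rewrite lerD2l -mulrA.
apply: le_trans (ler_wpM2r _ (_ : r <= 1)) _; last by rewrite mul1r ler_pM2l.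
- by apply: mulr_ge0 => //; exact: ltW.
- lra.
Qed.

Lemma RBG_movement_area T :
  area_le (fun r => \sum_(1 <= t < T.+1) m * `|sel t.+1 r - sel t r|) (w T a + w T b).
Proof.
(* [sel] is specified only for [|r| < 1]; complete it by the extreme minimizers. *)
pose ext t r := if r <= -1 then b else if 1 <= r then a else sel t r.
have extP t r : -1 <= r <= 1 -> tilted_min a b m (w t) r (ext t.+1 r).
  move=> hr; have [minb mina] := tilted_min_endpoints ab (work_lipschitz t).
  rewrite /ext; have [r1|r1] := lerP r (-1).
    by have -> : r = -1 by lra.
  have [r2|r2] := lerP 1 r; first by have -> : r = 1 by lra.
  by apply: RBG_tilted_min; lra.
have extN1 t : ext t (-1) = b by rewrite /ext lexx.
have ext1 t : ext t 1 = a.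
  by rewrite /ext lexx; by case: (lerP 1 (-1)) => // ?; lra.
pose D t := w t a - w t.-1 a + (w t b - w t.-1 b).
have area t : (1 <= t)%N -> area_le (fun r => m * `|sel t.+1 r - sel t r|) (D t).
  case: t => // t _.
  have [z Fz zmin] := lipschitz_on_argmin ab admissible_bound_ge0.1
    (admissible_lipschitz t.+1 adm).
  have cc : convex_on a b (c t.+1) by have [] := adm t.+1.
  apply: area_le_mono (movement_area m0 ab (work_convex t) (work_convex t.+1)
    (work_lipschitz t) cc (admissible_ge0 t.+1) (workS t) Fz zmin
    (extP t) (extP t.+1) (extN1 _) (ext1 _) (extN1 _) (ext1 _)) _ (lexx _).
  move=> u hu; rewrite /ext.
  have -> : (u <= -1) = false by apply/negbTE; rewrite -ltNge; lra.
  by have -> : (1 <= u) = false by apply/negbTE; rewrite -ltNge; lra.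
apply: area_le_mono (area_le_sum T area) (fun u _ => lexx _) _.
have -> : \sum_(1 <= t < T.+1) D t = w T a - w 0 a + (w T b - w 0 b).
  elim: T => [|T IH]; first by rewrite big_geq //; lra.
  by rewrite big_nat_recr // IH /D /=; lra.
by have := work_ge0 0 Fa; have := work_ge0 0 Fb; lra.
Qed.

(** [K0] covers service and fixed costs, and [lam] prices movement measured in [N]. The term
    [m * b / 2] comes from [w T b <= w T a + m * b] in the average. *)
Lemma RBG_expected_le T (f : R -> R) (K0 lam : R) :
  (forall t, measurable_on_pm1 (sel t)) -> 0 <= lam ->
  (forall r, -1 < r < 1 -> 0 <= f r <=
    K0 + lam * \sum_(1 <= t < T.+1) m * `|sel t.+1 r - sel t r|) ->
  (Er f <= (K0 + lam * (w T a + m * b / 2))%:E)%E.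
Proof.
move=> msel lam0 hf; apply: le_trans (Er_le hf) _.
apply: le_trans (integral_le_area _ _
  (area_leD (area_le_cst K0) (area_leZ lam0 (RBG_movement_area T)))) _.
- apply: measurable_funD; first exact: measurable_cst.
  apply: measurable_funM; first exact: measurable_cst.
  apply: measurable_sum => t; apply: measurable_funM; first exact: measurable_cst.
  apply: measurableT_comp; first exact: normr_measurable.
  by apply: measurable_funB; exact: msel.
- by move=> u /hf /andP[/le_trans h /h].
rewrite lee_fin.
have : w T b <= w T a + m * b.
  have := work_lipschitz T Fb Fa; rewrite ger0_norm ?subr_ge0 //.
  by have := mulr_ge0 (ltW m0) a0; lra.
move=> /(ler_wpM2l lam0); lra.
Qed.

End WorkFunction.

(** * Costs of a single run *)

(** The first move goes from 0 to [x 2]; the triangle inequality through [x 1] costs the extra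
    [k * b]. *)
Lemma cost1_le {R : realType} (nrm : R -> R) (k b : R) (c : nat -> R -> R) (T : nat)
    (x : nat -> R) :
  0 <= k -> 0 <= b -> (forall x, nrm x = k * `|x|) -> `|x 1%N| <= b ->
  cost1 nrm 1 c T x <=
    \sum_(1 <= t < T.+1) c t (x t.+1) + k * b + k * \sum_(1 <= t < T.+1) `|x t.+1 - x t|.
Proof.
move=> k0 b0 nrmE x1b; rewrite /cost1.
set x' := fun s => if s == 1%N then 0 else x s.
have kb0 : 0 <= k * b by exact: mulr_ge0.
case: T => [|T]; first by rewrite !big_geq //; lra.
have h : \sum_(1 <= t < T.+2) (c t (x' t.+1) + 1 * nrm (x' t.+1 - x' t)) =
    \sum_(1 <= t < T.+2) c t (x t.+1) + (k * `|x 2%N| +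
      k * \sum_(2 <= t < T.+2) `|x t.+1 - x t|).
  rewrite big_split /=; congr (_ + _).
    by apply: eq_big_nat => t /andP[t1 _]; rewrite /x'; case: t t1.
  rewrite big_ltn // {1 2}/x' /= subr0 mul1r nrmE mulr_sumr; congr (_ + _).
  by apply: eq_big_nat => -[|[|t]] //= _; rewrite /x' /= mul1r nrmE.
rewrite h -addrA lerD2l [in leRHS]big_ltn //=.
have := ler_normD (x 2%N - x 1%N) (x 1%N); rewrite subrK.
move=> /le_trans/(_ (lerD (lexx _) x1b))/(ler_wpM2l k0); lra.
Qed.

(** Without lookahead, [c t] is paid at [x t] instead of [x t.+1]. The Lipschitz bound charges the
    difference to movement, whose price becomes [G + k]. *)
Lemma cost0_le {R : realType} (nrm : R -> R) (k b G : R) (c : nat -> R -> R) (T : nat)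
    (x : nat -> R) :
  0 <= k -> 0 <= b -> (forall x, nrm x = k * `|x|) -> `|x 1%N| <= b ->
  (forall t, c t.+1 (x t.+1) - c t.+1 (x t.+2) <= G * `|x t.+1 - x t.+2|) ->
  cost0 nrm 1 c T x <= \sum_(1 <= t < T.+1) c t (x t.+1) + k * b
    + (G + k) * \sum_(1 <= t < T.+1) `|x t.+1 - x t|.
Proof.
move=> k0 b0 nrmE x1b lc; rewrite /cost0.
set x' := fun s => if s == 0%N then 0 else x s.
have kb0 : 0 <= k * b by exact: mulr_ge0.
have service S : \sum_(1 <= t < S.+1) c t (x' t) <=
    \sum_(1 <= t < S.+1) c t (x t.+1) + G * \sum_(1 <= t < S.+1) `|x t.+1 - x t|.
  rewrite mulr_sumr -big_split /=; apply: ler_sum_nat => -[//|t] _.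
  by rewrite /x' /= distrC; have := lc t; lra.
have movement S : \sum_(1 <= t < S.+2) nrm (x' t - x' t.-1) <=
    k * b + k * \sum_(1 <= t < S.+1) `|x t.+1 - x t|.
  elim: S => [|S IH].
    rewrite big_nat1 big_geq // /x' /= subr0 nrmE.
    by have := ler_wpM2l k0 x1b; lra.
  rewrite big_nat_recr // [in leRHS]big_nat_recr //= /x' /= nrmE; lra.
under eq_bigr do rewrite mul1r.
rewrite big_split /=; case: T => [|T]; first by rewrite !big_geq //; lra.
have := service T.+1; have := movement T.
rewrite [X in _ <= _ + (G + k) * X]big_nat_recr //= => h1.
rewrite [X in _ <= _ + G * X -> _]big_nat_recr //=.
have := mulr_ge0 k0 (normr_ge0 (x T.+2 - x T.+1)); lra.
Qed.


(** * The competitive ratio and the regret *)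

Unset Implicit Arguments.
Set Strict Implicit.
Theorem theorem4 (R : realType) (xL xH : R) (nrm : R -> R) (G B : R) :
  0 <= xL -> xL <= xH -> is_norm nrm ->
  (* alpha-unfair competitive ratio CR_1^alpha <= (1 + theta) / min(theta, alpha) *)
  (forall theta alpha : R, 1 <= theta -> 1 <= alpha ->
    exists K : R, forall (T : nat) (c : nat -> R -> R) (sel : nat -> R -> R),
      admissible_costs xL xH G B c ->
      RBG_selection xL xH nrm theta c sel ->
      (forall t, measurable_on_pm1 (sel t)) ->
      (Er (fun r => cost1 nrm 1 c T (fun s => sel s r))
        <= ((1 + theta) / Num.min theta alpha * OPT_d xL xH nrm alpha c T + K)%:E)%E)
  /\
  (* regret R'_0 = O(max(T/theta, theta)), uniformly in theta >= 1 *)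
  (exists K : R, forall (theta : R) (T : nat) (c : nat -> R -> R)
      (sel : nat -> R -> R),
      1 <= theta ->
      admissible_costs xL xH G B c ->
      RBG_selection xL xH nrm theta c sel ->
      (forall t, measurable_on_pm1 (sel t)) ->
      (Er (fun r => cost0 nrm 1 c T (fun s => sel s r))
        <= (OPT_s xL xH c T + K * Num.max (T%:R / theta) theta)%:E)%E).
Proof.
move=> a0 ab /is_norm_scale [k k0 nrmE].
have b0 : 0 <= xH by exact: le_trans ab.
have Fa : inF xL xH xL by rewrite /inF lexx.
have kb0 : 0 <= k * xH by apply: mulr_ge0 => //; exact: ltW.
have nrm0 v : 0 <= nrm v by rewrite nrmE; apply: mulr_ge0 => //; exact: ltW.
split.
  move=> theta alpha theta1 alpha1.
  set mu := Num.min theta alpha.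
  have mu1 : 1 <= mu by rewrite le_min theta1.
  have mu0 : 0 < mu by exact: lt_le_trans mu1.
  have theta0 : 0 < theta by exact: lt_le_trans theta1.
  have thetaV0 : 0 <= theta^-1 by rewrite invr_ge0 ltW.
  (* In order: the additive loss of [W] against [OPT_d], the service bound, the first move, and the
     movement average. *)
  exists ((1 + theta^-1) * (theta * k * xH) + theta * k * xH + k * xH
          + theta^-1 * (theta * k * xH / 2)).
  move=> T c sel adm rbg msel.
  set W := work xL xH nrm theta c T xL.
  have Wopt : W <= theta / mu * OPT_d xL xH nrm alpha c T + theta * k * xH.
    have q0 : 0 < theta / mu by exact: divr_gt0.
    suff : (W - theta * k * xH) / (theta / mu) <= OPT_d xL xH nrm alpha c T.
      by rewrite ler_pdivrMr // mulrC; lra.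
    apply: lb_le_inf; first by eexists; exists (fun=> xL).
    move=> _ [x /= Fx <-]; rewrite ler_pdivrMr //.
    have := work_le_dynamic a0 ab k0 theta1 nrmE adm Fx; rewrite -/W => hW.
    (* Termwise: [theta / mu >= 1] handles service, and [theta <= alpha * (theta / mu)] handles
       movement. *)
    suff : cost0 nrm theta c T x <= cost0 nrm alpha c T x * (theta / mu) by lra.
    rewrite /cost0 mulr_suml; apply: ler_sum_nat => -[//|t] /andP[_ tT] /=.
    have ct := admissible_ge0 adm t.+1 (Fx t.+1 tT).
    have q1 : 1 <= theta / mu by rewrite ler_pdivlMr // mul1r ge_min lexx.
    have qa : theta <= alpha * (theta / mu).
      rewrite mulrA ler_pdivlMr // mulrC ler_pM2r // ge_min lexx orbT //.
    set d := nrm _; have := ler_wpM2r (nrm0 _ : 0 <= d) qa; have := ler_wpM2l ct q1; lra.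
  apply: le_trans (RBG_expected_le a0 ab k0 theta1 nrmE adm rbg
    (K0 := W + theta * k * xH + k * xH) (lam := theta^-1) (T := T) msel thetaV0 _) _.
    move=> r hr.
    have Fs t := RBG_inF rbg t hr.
    apply/andP; split.
      rewrite /cost1 big_nat; apply: sumr_ge0 => -[//|t] _.
      rewrite mul1r addr_ge0 ?nrm0 //=; exact: admissible_ge0 adm _ _ (Fs _).
    apply: le_trans (cost1_le _ _ (ltW k0) b0 nrmE _) _.
      have /andP[h1 h2] := Fs 0%N; rewrite ger0_norm //; exact: le_trans h1.
    have := RBG_service_le a0 ab k0 theta1 nrmE adm rbg T hr; rewrite -/W.
    rewrite -mulr_sumr !mulrA mulVf ?mul1r; last exact: lt0r_neq0.
    lra.
  rewrite lee_fin -/W.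
  have -> : (1 + theta) / mu * OPT_d xL xH nrm alpha c T =
      (1 + theta^-1) * (theta / mu * OPT_d xL xH nrm alpha c T).
    by field; rewrite !lt0r_neq0.
  have := ler_wpM2l (addr_ge0 ler01 thetaV0) Wopt; lra.
(* The first term multiplies [theta], the last [T / theta], and the middle ones 1; all three factors
   are at most the maximum. *)
exists (k * xH * 3 + k * xH + (G + k) * (xH + xH / 2) + (G + k) / k * B).
move=> theta T c sel theta1 adm rbg msel.
have [G0 B0] := admissible_bound_ge0 ab adm.
have theta0 : 0 < theta by exact: lt_le_trans theta1.
set W := work xL xH nrm theta c T xL; set M := Num.max _ _.
have Wopt : W <= OPT_s xL xH c T + 2 * (theta * k * xH).
  suff : W - 2 * (theta * k * xH) <= OPT_s xL xH c T by lra.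
  apply: lb_le_inf; first by eexists; exists xL.
  move=> _ [x /= Fx <-].
  have := work_le_static a0 ab k0 theta1 nrmE adm T Fx.
  have := work_lipschitz a0 ab k0 theta1 nrmE adm T Fa Fx.
  have /andP[ax xb] := Fx.
  have m0 : 0 <= theta * k by apply: mulr_ge0; exact: ltW.
  have : `|xL - x| <= xH by rewrite ler0_norm; lra.
  move=> /(ler_wpM2l m0); rewrite -/W; lra.
(* In the movement term [W] carries the factor [(G + k) / (theta * k)], so this crude bound yields
   [T / theta]. The service term uses [Wopt], which keeps coefficient 1 on [OPT_s]. *)
have WB : W <= theta * k * xH + T%:R * B.
  have := work_le_static a0 ab k0 theta1 nrmE adm T Fa; rewrite -/W => /le_trans; apply.
  rewrite lerD2l; elim: (T) => [|S IH]; first by rewrite big_geq // mul0r.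
  rewrite big_nat_recr //= -natr1; have [_ [/(_ _ Fa)/andP[_ h] _]] := adm S.+1; lra.
have lam0 : 0 <= (G + k) / (theta * k).
  by apply: divr_ge0; [apply: addr_ge0 => //; exact: ltW | apply: mulr_ge0; exact: ltW].
apply: le_trans (RBG_expected_le a0 ab k0 theta1 nrmE adm rbg
    (K0 := W + theta * k * xH + k * xH) (lam := (G + k) / (theta * k)) (T := T) msel lam0 _) _.
  move=> r hr.
  have Fs t := RBG_inF rbg t hr.
  apply/andP; split.
    rewrite /cost0 big_nat; apply: sumr_ge0 => -[//|t] _.
    rewrite mul1r addr_ge0 ?nrm0 //=; exact: admissible_ge0 adm _ _ (Fs _).
  apply: le_trans (cost0_le (G := G) _ (ltW k0) b0 nrmE _ _) _.
  - have /andP[h1 h2] := Fs 0%N; rewrite ger0_norm //; exact: le_trans h1.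
  - by move=> t; exact: (admissible_lipschitz t.+1 adm).
  have := RBG_service_le a0 ab k0 theta1 nrmE adm rbg T hr; rewrite -/W.
  rewrite -mulr_sumr mulrA divfK; last by rewrite lt0r_neq0 // mulr_gt0.
  lra.
rewrite lee_fin -/W.
have M1 : theta <= M by rewrite le_max lexx orbT.
have M2 : T%:R / theta <= M by rewrite le_max lexx.
have : (G + k) / (theta * k) * (W + theta * k * xH / 2) <=
   (G + k) * (xH + xH / 2) + (G + k) / k * B * (T%:R / theta).
  apply: le_trans (ler_wpM2l lam0 (lerD WB (lexx _))) _.
  by rewrite le_eqVlt; apply/orP; left; apply/eqP; field; rewrite !lt0r_neq0.
have e1 : k * xH * 3 * theta <= k * xH * 3 * M by rewrite ler_wpM2l // mulr_ge0.
have e2 : (k * xH + (G + k) * (xH + xH / 2)) * 1 <= (k * xH + (G + k) * (xH + xH / 2)) * M.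
  rewrite ler_wpM2l //; last exact: le_trans M1.
  by apply: addr_ge0 => //; apply: mulr_ge0; lra.
have e3 : (G + k) / k * B * (T%:R / theta) <= (G + k) / k * B * M.
  by rewrite ler_wpM2l // mulr_ge0 // divr_ge0 //; lra.
lra.
Qed.
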